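(* Let $(\Omega,\mathcal F,\mathbb P)$ be a nonatomic probability space and $0\le p\le\infty$. Let $A\in\mathcal F$ and define $\mathcal A(A)=\{X\in L^p : X1_A\ge0\}$. If $S=(S_0,S_T)$ is a traded asset, then $\rho_{\mathcal A(A),S}$ is cash subadditive if and only if $\mathbb P(A\cap\{S_T<S_0\})=0$.
   Context: $L^p=L^p(\Omega,\mathcal F,\mathbb P)$; inequalities between random variables are understood almost surely, and $L^p_+$ is the positive cone. A traded asset is a pair $S=(S_0,S_T)$ with $S_0>0$ real and $S_T\in L^p_+$ nonzero. For a monotone set $\mathcal A\subset L^p$ ($X\in\mathcal A$, $Y\ge X$ imply $Y\in\mathcal A$) the risk measure is $\rho_{\mathcal A,S}(X)=\inf\{m\in\mathbb R : X+\frac{m}{S_0}S_T\in\mathcal A\}\in\mathbb R\cup\{\pm\infty\}$ with $\inf\emptyset=\infty$. A function $\rho:L^p\to\mathbb R\cup\{\pm\infty\}$ is cash subadditive if it is decreasing ($X\le Y$ implies $\rho(X)\ge\rho(Y)$) and $\rho(X+\lambda 1_\Omega)\ge\rho(X)-\lambda$ for all $\lambda>0$ and $X\in L^p$ (with $\pm\infty-\lambda=\pm\infty$). *)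

(* Defs.v *)
From HB Require Import structures.
From mathcomp Require Import all_boot all_order all_algebra.
From mathcomp Require Import all_classical all_reals all_analysis.

Set Implicit Arguments.
Unset Strict Implicit.
Unset Printing Implicit Defensive.
Import Order.TTheory GRing.Theory Num.Theory.
Import numFieldNormedType.Exports.
Local Open Scope classical_set_scope.
Local Open Scope ring_scope.

(* Elements of L^p are represented by functions [X : T -> R] satisfying
   [X \in Lfun P p], with all equalities and inequalities holding P-almost
   surely. The parameter [p] ranges over the extended reals in [0, +oo];
   the lemma [Lfun0E] below checks that [Lfun P 0] is the space of all
   random variables. *)

Section defs.
Context (d : measure_display) (T : measurableType d) (R : realType).
Variables (P : probability T R) (p : \bar R).

Lemma Lfun0E (X : T -> R) : (X \in Lfun P 0) = (X \in mfun).
Proof.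
apply/idP/idP => [/andP[]//|mX]; apply/andP; split => //=.
by apply/mem_set; rewrite /= /finite_norm unlock /= invr0 poweRe0 ltry.
Qed.

Definition nonatomic : Prop :=
  forall E : set T, measurable E -> (0 < P E)%E ->
    exists F : set T,
      [/\ measurable F, F `<=` E, (0 < P F)%E & (P F < P E)%E].

Definition le_as (X Y : T -> R) : Prop := {ae P, forall w, X w <= Y w}.

Record traded_asset := TradedAsset {
  price0 : R;
  payoff : T -> R;
  price0_gt0 : 0 < price0;
  payoff_Lfun : payoff \in Lfun P p;
  payoff_ge0 : le_as (cst 0) payoff;
  payoff_neq0 : ~ {ae P, forall w, payoff w = 0}
}.

Definition monotone_set (Acc : set (T -> R)) : Prop :=
  Acc `<=` [set X | X \in Lfun P p] /\
  forall X Y, Acc X -> Y \in Lfun P p -> le_as X Y -> Acc Y.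

(* [ereal_inf set0 = +oo]. *)
Definition risk_measure (Acc : set (T -> R)) (S : traded_asset)
    (X : T -> R) : \bar R :=
  ereal_inf [set m%:E | m in
    [set m : R | Acc (fun w => X w + m / price0 S * payoff S w)]].

(* In [\bar R], [+oo - l%:E = +oo] and [-oo - l%:E = -oo]. *)
Definition cash_subadditive (rho : (T -> R) -> \bar R) : Prop :=
  (forall X Y, X \in Lfun P p -> Y \in Lfun P p ->
     le_as X Y -> (rho Y <= rho X)%E) /\
  (forall (l : R) X, 0 < l -> X \in Lfun P p ->
     (rho X - l%:E <= rho (fun w => (X w + l)%R))%E).

Definition acceptance_on (A : set T) : set (T -> R) :=
  [set X | X \in Lfun P p /\ le_as (cst 0) (fun w => X w * \1_A w)].

Lemma monotone_acceptance_on (A : set T) : monotone_set (acceptance_on A).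
Proof.
split=> [X []//|X Y [_ X0] LY XY]; split=> //.
apply: filterS2 X0 XY => w /= X0 XY; apply: le_trans X0 _.
by rewrite ler_wpM2r.
Qed.

End defs.

(* Main.v *)
(* If S_T >= S_0 on A and X + l + (m/S_0) S_T >= 0 on A, then
   X + ((m+l)/S_0) S_T >= 0 on A, which gives cash subadditivity. Conversely,
   for 0 < c < S_0 put B = A /\ {S_T <= c}. If P(B) > 0, then X = -1_B has risk
   at least S_0/c > 1, while X + 1 >= 0 has risk at most 0, against cash
   subadditivity with l = 1. Letting c increase to S_0 gives the claim. *)
Require Import Defs.
From HB Require Import structures.
From mathcomp Require Import all_boot all_order all_algebra.
From mathcomp Require Import all_classical all_reals all_analysis.
From mathcomp Require Import measurable_realfun ess_sup_inf.

Set Implicit Arguments.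
Unset Strict Implicit.
Unset Printing Implicit Defensive.
Import Order.TTheory GRing.Theory Num.Theory.
Import numFieldNormedType.Exports.
Local Open Scope classical_set_scope.
Local Open Scope ring_scope.

(** * Linear combinations and bounded functions in $L^p$, for all $0\le p\le\infty$ *)

Lemma powRD_le (R : realType) (r a b : R) : 0 <= r -> 0 <= a -> 0 <= b ->
  (a + b) `^ r <= 2 `^ r * (a `^ r + b `^ r).
Proof.
move=> r0; wlog ab : a b / a <= b => [th a0 b0|a0 b0].
  case/orP: (le_total a b) => ab; first exact: th.
  by rewrite addrC [a `^ r + _]addrC th.
(* With $a\le b$ the sum is at most $2b$. This uses only monotonicity of the power, so it also
   covers $r<1$, where convexity fails. *)
apply: (@le_trans _ _ ((2 * b) `^ r)).
  apply: ge0_ler_powR => //; rewrite ?nnegrE ?addr_ge0 ?mulr_ge0//.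
  by rewrite mulr_natl mulr2n lerD2r.
by rewrite powRM// ler_pM2l ?powR_gt0// lerDr powR_ge0.
Qed.

Section Lfun_quasinorm.
Context (d : measure_display) (T : measurableType d) (R : realType).

Lemma measurable_normr_powR (X : T -> R) (r : R) :
  measurable_fun setT X -> measurable_fun setT (fun w => `|X w| `^ r).
Proof.
move=> mX; apply: measurableT_comp (measurable_powR r) _.
exact: measurableT_comp.
Qed.

(** Reduces membership in $L^r$ to integrability, so that domination arguments work uniformly in
    $r>0$. The outer power $1/r$ of the norm does not affect finiteness. *)
Lemma Lfun_powR_integrable (mu : {measure set T -> \bar R}) (r : R)
    (X : T -> R) : 0 < r ->
  X \in Lfun mu r%:E <-> measurable_fun setT X /\
    mu.-integrable setT (EFin \o (fun w => `|X w| `^ r)).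
Proof.
move=> r0.
have absE w : `| `|X w| `^ r| = `|X w| `^ r by rewrite ger0_norm ?powR_ge0.
have NE : 'N[mu]_r%:E[EFin \o X]%E
    = ((\int[mu]_w (`|X w| `^ r)%:E) `^ r^-1)%E.
  by rewrite unlock; congr (_ `^ _)%E; apply: eq_integral.
split=> [/andP[/set_mem/= mX /set_mem/=]|[mX /integrableP[_ iX]]].
  rewrite /finite_norm NE => /lty_poweRy-/(_ (lt0r_neq0 _)) iX.
  split=> //; apply/integrableP; split.
    exact/measurable_EFinP/measurable_normr_powR.
  under eq_integral do rewrite /= absE.
  by apply: iX; rewrite invr_gt0.
apply/andP; split; apply/mem_set => //=.
rewrite /finite_norm NE; apply: poweR_lty.
by move: iX; under eq_integral do rewrite /= absE.
Qed.

(* [Lfun_submod_closed] needs [1 <= p]; below [1] there is only the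
   quasi-triangle inequality [powRD_le]. *)
Lemma Lfun_addZ (mu : {measure set T -> \bar R}) (p : \bar R) (X Y : T -> R)
    (a : R) : (0 < p)%E -> X \in Lfun mu p -> Y \in Lfun mu p ->
  (fun w => X w + a * Y w) \in Lfun mu p.
Proof.
case: p => [r|_|//]; last first.
  move=> LX LY.
  have [_ /(_ a Y X LY LX)] := Lfun_submod_closed mu (leey (1 : \bar R)).
  by rewrite addrC.
rewrite lte_fin => r0 /(Lfun_powR_integrable _ _ r0)[mX iX].
move=> /(Lfun_powR_integrable _ _ r0)[mY iY].
have mZ : measurable_fun setT (fun w => X w + a * Y w).
  by apply: measurable_funD => //; exact: measurable_funM.
apply/(Lfun_powR_integrable _ _ r0); split=> //.
(* The dominating function is $2^r|X|^r+2^r|a|^r|Y|^r$, from the triangle inequality followed by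
   [powRD_le] applied to $|X|$ and $|a||Y|$. *)
have := integrableD measurableT
  (integrableZl measurableT (2 `^ r) iX)
  (integrableZl measurableT (2 `^ r * `|a| `^ r) iY).
apply: le_integrable => //.
  exact/measurable_EFinP/measurable_normr_powR.
move=> w _ /=; rewrite lee_fin.
rewrite [leLHS]ger0_norm ?powR_ge0//.
rewrite [leRHS]ger0_norm ?addr_ge0 ?mulr_ge0 ?powR_ge0//.
rewrite -mulrA -mulrDr -powRM//.
apply: (@le_trans _ _ ((`|X w| + `|a| * `|Y w|) `^ r)); last first.
  by apply: powRD_le; rewrite ?(ltW r0)// mulr_ge0.
apply: ge0_ler_powR; rewrite ?(ltW r0) ?nnegrE ?addr_ge0 ?mulr_ge0//.
by rewrite -normrM ler_normD.
Qed.

Lemma Lfun_bounded (P : probability T R) (p : \bar R) (X : T -> R) (M : R) :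
  (0 <= p)%E -> measurable_fun setT X -> (forall w, `|X w| <= M) ->
  X \in Lfun P p.
Proof.
move=> p0 mX XM; move: p0; rewrite le_eqVlt => /predU1P[<-|].
  by rewrite Lfun0E; exact/mem_set.
case: p => [r|_|//]; last first.
  apply/andP; split; apply/mem_set => //=.
  (* For $p=\infty$ the norm is an essential supremum, here at most [M]. *)
  rewrite /finite_norm unlock /=; case: ifPn => // _.
  apply: le_lt_trans (ltry M); apply/ess_supP.
  by apply: nearW => w /=; rewrite lee_fin.
rewrite lte_fin => r0; apply/(Lfun_powR_integrable _ _ r0); split=> //.
have := finite_measure_integrable_cst P (M `^ r) measurableT.
apply: le_integrable => //.
  exact/measurable_EFinP/measurable_normr_powR.
move=> w _ /=; rewrite lee_fin [leLHS]ger0_norm ?[leRHS]ger0_norm ?powR_ge0//.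
by apply: ge0_ler_powR; rewrite ?(ltW r0) ?nnegrE ?(le_trans _ (XM w)).
Qed.

End Lfun_quasinorm.

Lemma Lfun_probability_addZ (d : measure_display) (T : measurableType d)
    (R : realType) (P : probability T R) (p : \bar R) (X Y : T -> R) (a : R) :
  (0 <= p)%E -> X \in Lfun P p -> Y \in Lfun P p ->
  (fun w => X w + a * Y w) \in Lfun P p.
Proof.
rewrite le_eqVlt => /predU1P[<-|]; last exact: Lfun_addZ.
rewrite !Lfun0E => /set_mem/= mX /set_mem/= mY; apply/mem_set => /=.
by apply: measurable_funD => //; exact: measurable_funM.
Qed.

(** * The two implications, the second at a fixed level $c<S_0$ *)

Section acceptance_on.
Context (d : measure_display) (T : measurableType d) (R : realType).
Variables (P : probability T R) (p : \bar R) (A : set T).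

Lemma acceptance_onP (X : T -> R) : acceptance_on P p A X <->
  X \in Lfun P p /\ {ae P, forall w, A w -> 0 <= X w}.
Proof.
split=> -[LX X0]; split=> //; apply: filterS X0 => w /=.
  by move=> + Aw; rewrite indicE mem_set// mulr1.
rewrite indicE => X0; case: (pselect (A w)) => Aw; last by rewrite memNset// mulr0.
by rewrite mem_set// mulr1; exact: X0.
Qed.

Lemma risk_measure_acceptance_on_cash_subadditive (S : traded_asset P p) :
  (0 <= p)%E -> {ae P, forall w, A w -> price0 S <= payoff S w} ->
  cash_subadditive P p (risk_measure (acceptance_on P p A) S).
Proof.
move=> p0 AS; have S0 := price0_gt0 S.
have LXS X m : X \in Lfun P p -> (fun w => X w + m * payoff S w) \in Lfun P p.
  by move=> LX; exact: Lfun_probability_addZ p0 LX (payoff_Lfun S).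
split=> [X Y LX LY XY|l X l0 LX].
  apply: ereal_inf_le_tmp => _ [m /acceptance_onP[_ Xm] <-].
  exists m => //; apply/acceptance_onP; split; first exact: LXS.
  apply: filterS2 XY Xm => w /= XY /[apply]; move/le_trans; apply.
  by rewrite lerD2r.
apply: le_ereal_inf_tmp => _ [m /acceptance_onP[_ Xm] <-].
rewrite leeBlDr// -EFinD; apply: ereal_inf_lbound.
exists (m + l) => //; apply/acceptance_onP; split; first exact: LXS.
apply: filterS2 AS Xm => w /= AS Xm Aw.
(* It remains to see that $l\le (l/S_0)S_T$, which is $S_T\ge S_0$ on $A$. *)
apply: (le_trans (Xm Aw)); rewrite -addrA lerD2l addrC mulrDl mulrDl lerD2l.
by rewrite mulrAC ler_pdivlMr// ler_pM2l// AS.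
Qed.

Lemma cash_subadditive_price0_le (S : traded_asset P p) (c : R) :
  (0 <= p)%E -> measurable A -> 0 < c < price0 S ->
  cash_subadditive P p (risk_measure (acceptance_on P p A) S) ->
  P (A `&` [set w | payoff S w <= c]) = 0%E.
Proof.
move=> p0 mA /andP[c0 cS] [_ sub]; have S0 := price0_gt0 S.
set B := A `&` _.
have /andP[/set_mem/= mS _] := payoff_Lfun S.
have mB : measurable B.
  have -> : B = A `&` [set w | payoff S w <= cst c w] by [].
  by apply: measurable_fun_le => //; exact: measurable_funS mS.
have [//|PB] := eqVneq (P B) 0%E; exfalso.
pose X : T -> R := fun w => - \1_B w.
have mX : measurable_fun setT X.
  by apply: measurable_funN; exact: measurable_indic.
have B01 w : 0 <= (\1_B w : R) <= 1.
  by rewrite indicE; case: (w \in B); rewrite ?lexx ?ler01.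
have LX : X \in Lfun P p.
  apply: (@Lfun_bounded _ _ _ _ _ _ 1) => // w; have /andP[? ?] := B01 w.
  by rewrite /X normrN ger0_norm.
have LX1 : (fun w => X w + 1) \in Lfun P p.
  apply: (@Lfun_bounded _ _ _ _ _ _ 1) => //.
    exact: measurable_funD.
  move=> w; have /andP[? ?] := B01 w.
  by rewrite /X addrC ger0_norm ?subr_ge0// gerBl.
have rX : ((price0 S / c)%:E <= risk_measure (acceptance_on P p A) S X)%E.
  apply: le_ereal_inf_tmp => _ [m /acceptance_onP[_ Xm] <-].
  rewrite lee_fin leNgt; apply/negP => mc.
  (* Acceptability of some $m<S_0/c$ would force $(m/S_0)S_T\ge 1$ almost surely on $B$, which fails
     at almost every point of $B$, so $B$ would be null. *)
  move/negP: PB; apply; apply/eqP/negligibleP => //.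
  have : {ae P, forall w, ~ B w}.
    apply: filterS2 Xm (payoff_ge0 S) => w /= Xm Sw Bw.
    have [Aw Sc] := Bw; have := Xm Aw.
    rewrite /X indicE mem_set//= addrC subr_ge0 => h.
    suff : m / price0 S * payoff S w < 1 by rewrite ltNge h.
    (* For $m\le 0$ the bound comes from $S_T\ge 0$; for $m>0$ it comes from $S_T\le c$ and
       $mc<S_0$. *)
    have [m0|m0] := leP m 0.
      apply: le_lt_trans ltr01; rewrite mulr_le0_ge0// pmulr_lle0//.
      by rewrite invr_gt0.
    apply: (@le_lt_trans _ _ (m / price0 S * c)).
      by rewrite ler_pM2l// divr_gt0.
    by rewrite mulrAC ltr_pdivrMr// mul1r -ltr_pdivlMr.
  by apply: negligibleS => w /=; rewrite notK.
have rX1 : (risk_measure (acceptance_on P p A) S (fun w => (X w + 1)%R)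
    <= 0)%E.
  apply: ereal_inf_lbound; exists 0 => //=.
  have -> : (fun w => X w + 1 + 0 / price0 S * payoff S w)
      = (fun w => X w + 1).
    by apply/funext => w; rewrite !mul0r addr0.
  apply/acceptance_onP; split=> //.
  by apply: nearW => w _; rewrite /X addrC subr_ge0; have /andP[] := B01 w.
(* Cash subadditivity would give $\rho(X)-1\le\rho(X+1)\le 0$, whereas $\rho(X)\ge S_0/c>1$. *)
have /le_trans/(_ rX1) := sub 1 X ltr01 LX.
apply/negP; rewrite -ltNge sube_gt0.
by apply: lt_le_trans rX; rewrite lte_fin ltr_pdivlMr// mul1r.
Qed.

End acceptance_on.

Theorem corollary5p4 (d : measure_display) (T : measurableType d)
    (R : realType) (P : probability T R) (hP : nonatomic P)
    (p : \bar R) (hp : (0 <= p)%E)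
    (A : set T) (hA : measurable A) (S : traded_asset P p) :
  cash_subadditive P p (risk_measure (acceptance_on P p A) S)
  <-> P (A `&` [set w | payoff S w < price0 S]) = 0%E.
Proof.
have S0 := price0_gt0 S.
have /andP[/set_mem/= mS _] := payoff_Lfun S.
have mle c : measurable (A `&` [set w | payoff S w <= c]).
  have -> : [set w | payoff S w <= c] = [set w | payoff S w <= cst c w] by [].
  by apply: measurable_fun_le => //; exact: measurable_funS mS.
have mlt : measurable (A `&` [set w | payoff S w < price0 S]).
  have -> : A `&` [set w | payoff S w < price0 S]
      = A `\` (A `&` [set w | price0 S <= payoff S w]).
    apply/seteqP; split=> w /=.
      by move=> [Aw]; rewrite ltNge => /negP; split=> // -[].
    by move=> [Aw nle]; split=> //; rewrite ltNge; apply/negP => le; exact: nle.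
  apply: measurableD => //.
  have -> : [set w | price0 S <= payoff S w]
      = [set w | cst (price0 S) w <= payoff S w] by [].
  by apply: measurable_fun_le => //; exact: measurable_funS mS.
split=> [sub|].
  (* Levels increasing to $S_0$; the shift to [n.+2] keeps [c 0] positive. *)
  pose c n : R := price0 S * (1 - n.+2%:R^-1).
  have c_in n : 0 < c n < price0 S.
    rewrite pmulr_rgt0// subr_gt0 invf_lt1 ?ltr1n//=.
    by rewrite gtr_pMr// gtrBl invr_gt0.
  have c_null n := cash_subadditive_price0_le hp hA (c_in n) sub.
  apply/negligibleP => //.
  apply: (@negligibleS _ _ _ P
      (\bigcup_n (A `&` [set w | payoff S w <= c n]))); last first.
    by apply: negligible_bigcup => n; exact/(negligibleP _ (mle _))/c_null.
  move=> w [Aw /= wS].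
  (* With [e] the relative shortfall, $S_T\le c_n$ amounts to $1/(n+2)\le e$. Truncating $1/e$ gives
     $1/e<n+1<n+2$. *)
  pose e := 1 - payoff S w / price0 S.
  have e0 : 0 < e by rewrite subr_gt0 ltr_pdivrMr// mul1r.
  pose n := Num.truncn e^-1.
  exists n => //; split=> //=.
  rewrite /c mulrC -ler_pdivrMr// lerBrDl -lerBrDr -/e.
  rewrite invf_ple ?posrE//; apply: ltW; apply: lt_trans (truncnS_gt _) _.
  by rewrite ltr_nat.
move=> /(negligibleP _ mlt) Anull.
apply: risk_measure_acceptance_on_cash_subadditive => //.
(* The implication $S_T\ge S_0$ on $A$ fails exactly on the given null set. *)
apply: negligibleS Anull => w /= /not_implyP[Aw /negP].
by rewrite -ltNge.
Qed.
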